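(* For all integers $n \ge 0$, $k \ge 0$ and $r \ge 1$, $$\phi_{n+k,k}(r) = \left\{ {n+k+1 \atop n+1} \right\} \cdot \phi_n(r).$$
   Context: $\mathbb{Z}^n$ is the ring of $n$-tuples of integers with componentwise addition and multiplication. A lattice (sublattice) in $\mathbb{Z}^n$ is a $\mathbb{Z}$-submodule $L \subseteq \mathbb{Z}^n$; its co-rank is $n - \operatorname{rank}_{\mathbb{Z}} L$. A sublattice is closed under multiplication if $u \cdot v \in L$ for all $u,v \in L$ (it is not required to contain the identity $(1,\dots,1)$). For $0 \le k \le n$ and $r \ge 1$, $\phi_{n,k}(r)$ is the number of sublattices $L$ of $\mathbb{Z}^n$ such that: $L$ is closed under multiplication; $L$ has co-rank $k$ in $\mathbb{Z}^n$; and the torsion subgroup of $\mathbb{Z}^n/L$ has exactly $r$ elements. Also $\phi_n(r) = \phi_{n,0}(r)$, i.e. the number of full-rank sublattices of $\mathbb{Z}^n$ of index $r$ that are closed under multiplication. For natural numbers $u,v$, $\left\{ {u \atop v} \right\}$ is the Stirling number of the second kind: the number of partitions of a set with $u$ elements into $v$ non-empty subsets. *)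

(* Defs.v *)
From HB Require Import structures.
From mathcomp Require Import all_boot all_order all_algebra.

Set Implicit Arguments.
Unset Strict Implicit.
Unset Printing Implicit Defensive.

Import Order.TTheory GRing.Theory Num.Theory.
Local Open Scope ring_scope.

(* [partition] requires the blocks to be non-empty. *)
Definition stirling2 (u v : nat) : nat :=
  #|[set P : {set {set 'I_u}} | partition P [set: 'I_u] & #|P| == v]|.

(* Loaded only now: from here on the set notations denote classical sets. *)
From mathcomp Require Import finmap.
From mathcomp Require Import mathcomp_extra boolp classical_sets functions cardinality.

Local Open Scope classical_set_scope.

(* The ring structure on finite functions is componentwise, and exists for
   n = 0 as well. *)
Notation "''Zn_' n" := {ffun 'I_n -> int}
  (at level 8, n at level 2, format "''Zn_' n") : type_scope.

Definition is_sublattice n (L : set 'Zn_n) : Prop :=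
  [/\ L 0,
      forall u v, L u -> L v -> L (u + v) &
      forall (a : int) u, L u -> L (u *~ a)].

Definition mul_closed n (L : set 'Zn_n) : Prop :=
  forall u v, L u -> L v -> L (u * v).

Definition Zindependent n m (b : 'I_m -> 'Zn_n) : Prop :=
  forall c : 'I_m -> int, \sum_(i < m) b i *~ c i = 0 -> forall i, c i = 0.

Definition has_rank n (L : set 'Zn_n) (d : nat) : Prop :=
  (exists b : 'I_d -> 'Zn_n, (forall i, L (b i)) /\ Zindependent b) /\
  (forall m (b : 'I_m -> 'Zn_n),
     (forall i, L (b i)) -> Zindependent b -> (m <= d)%N).

Definition has_corank n (L : set 'Zn_n) (k : nat) : Prop :=
  exists2 d, has_rank L d & (d + k)%N = n.

(* The torsion subgroup of Z^n / L, as a set of cosets: v + L is torsion when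
   some positive multiple of v lies in L. *)
Definition quotient_torsion n (L : set 'Zn_n) : set (set 'Zn_n) :=
  [set [set v + l | l in L]
     | v in [set v : 'Zn_n | exists2 m : nat, (0 < m)%N & L (v *+ m)]].

Definition mul_sublattices (n k r : nat) : set (set 'Zn_n) :=
  [set L | [/\ is_sublattice L, mul_closed L, has_corank L k &
               (quotient_torsion L #= `I_r)%card]].
Arguments mul_sublattices : clear implicits.

(* [fset_set] is empty on infinite sets, so this is the number of such
   sublattices only when [mul_sublattices n k r] is finite. *)
Definition phi_corank (n k r : nat) : nat :=
  #|` fset_set (mul_sublattices n k r)|%fset.

Definition phi (n r : nat) : nat := phi_corank n 0 r.

(* Main.v *)
(** Let [L] be a multiplicatively closed sublattice of Z^N, and call two
    coordinates inseparable when every vector of [L] agrees on them; an extra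
    coordinate, on which all vectors vanish, is thrown in. The classes partition
    N + 1 points. For each class [B] not containing the extra point, multiplying
    vectors that separate [B] from the other classes gives a nonzero multiple of
    the indicator of [B] in [L], so the rank of [L] is the number of classes
    minus one. Hence [L] is the image of a full-rank multiplicatively closed
    lattice of Z^n under the embedding Z^n -> Z^N attached to a partition of
    N + 1 points into n + 1 blocks. That embedding preserves the torsion of the
    quotient, and the partition is recovered from [L] as its inseparability
    classes. Finiteness: a full-rank lattice of index [r] contains r! Z^n. *)
Require Import Defs.
From mathcomp Require Import all_boot all_order all_algebra.

Set Implicit Arguments.
Unset Strict Implicit.
Unset Printing Implicit Defensive.

Import Order.TTheory GRing.Theory Num.Theory.

(** * Set partitions and the numbering of their blocks *)

Definition set_partitions (T : finType) (m : nat) : {set {set {set T}}} :=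
  [set P | partition P [set: T] & #|P| == m].

Lemma set_partitionsP (T : finType) m (P : {set {set T}}) :
  reflect (partition P [set: T] /\ #|P| = m) (P \in set_partitions T m).
Proof. by rewrite inE; apply: (iffP andP) => -[partP /eqP]. Qed.

Section BlockIndex.
Variables (T : finType) (P : {set {set T}}) (x0 : T) (n : nat).

(* Numbers the blocks of [P] other than the one of [x0], which gets [None]. *)
Definition block_index (x : T) : option 'I_n :=
  insub (index (pblock P x) (enum (P :\ pblock P x0))).

Hypothesis PQ : P \in set_partitions T n.+1.

Let partP : partition P [set: T]. Proof. by have [] := set_partitionsP _ _ PQ. Qed.
Let cardP : #|P| = n.+1. Proof. by have [] := set_partitionsP _ _ PQ. Qed.

Let blockP x : pblock P x \in P.
Proof. by rewrite pblock_mem // (cover_partition partP) inE. Qed.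

Let size_others : size (enum (P :\ pblock P x0)) = n.
Proof. by rewrite -cardE; move: cardP; rewrite (cardsD1 (pblock P x0)) blockP => -[]. Qed.

Lemma block_index0 : block_index x0 = None.
Proof.
by rewrite /block_index insubF // -size_others index_mem mem_enum !inE eqxx.
Qed.

Lemma block_index_surj j : exists x, block_index x = Some j.
Proof.
pose B := nth set0 (enum (P :\ pblock P x0)) j.
have jlt : j < size (enum (P :\ pblock P x0)) by rewrite size_others.
have : B \in P :\ pblock P x0 by rewrite -mem_enum mem_nth.
rewrite inE => /andP[_ BP].
have /set0Pn[x xB] := partition_neq0 partP BP.
exists x; rewrite /block_index (def_pblock (partition_trivIset partP) BP xB).
by rewrite index_uniq ?enum_uniq // valK.
Qed.

(** A block other than that of [x0] is determined by its position in the enumeration, and only the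
    block of [x0] is missing from it, so all points numbered [None] lie together. *)
Lemma block_index_eq x y : (block_index x == block_index y) = (y \in pblock P x).
Proof.
rewrite -eq_pblock ?(partition_trivIset partP) ?(cover_partition partP) ?inE //.
apply/eqP/eqP=> [|eqxy]; last by rewrite /block_index eqxy.
have dflt z : (pblock P z == pblock P x0)
    = ~~ (index (pblock P z) (enum (P :\ pblock P x0)) < n).
  by rewrite -size_others index_mem mem_enum !inE blockP andbT negbK.
rewrite /block_index; case: insubP => [u ltx ux|gex]; case: insubP => [v lty vy|gey] //.
- case=> euv; have := congr1 val euv; rewrite /= ux vy => eqi.
  have mx : pblock P x \in enum (P :\ pblock P x0) by rewrite -index_mem size_others.
  have my : pblock P y \in enum (P :\ pblock P x0) by rewrite -index_mem size_others.
  by rewrite -(nth_index set0 mx) eqi nth_index.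
- by move=> _; move: gex gey; rewrite -!dflt => /eqP-> /eqP->.
Qed.

End BlockIndex.

(** The blocks are the fibres of the numbering, so its kernel alone determines the partition,
    whatever the order of enumeration. *)
Lemma block_index_inj (T : finType) (P Q : {set {set T}}) x0 n :
  P \in set_partitions T n.+1 -> Q \in set_partitions T n.+1 ->
  (forall x y, block_index P x0 n x = block_index P x0 n y <->
               block_index Q x0 n x = block_index Q x0 n y) -> P = Q.
Proof.
move=> PP QQ eqPQ.
have [[partP _] [partQ _]] := (set_partitionsP _ _ PP, set_partitionsP _ _ QQ).
rewrite -(equivalence_partition_pblock partP) -(equivalence_partition_pblock partQ).
apply: eq_imset => x; apply/setP=> y.
rewrite !inE -(block_index_eq x0 PP) -(block_index_eq x0 QQ).
by apply/eqP/eqP => /eqPQ.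
Qed.

Lemma equivalence_block_index (T : finType) (R : rel T) x0 : equivalence_rel R ->
  exists n, exists2 P, P \in set_partitions T n.+1 &
    forall x y, (block_index P x0 n x == block_index P x0 n y) = R x y.
Proof.
move=> eqR; have eqRT : {in [set: T] & &, equivalence_rel R} by move=> x y z _ _ _; exact: eqR.
pose P := equivalence_partition R [set: T].
have partP : partition P [set: T] := equivalence_partitionP eqRT.
(* The block of [x0] exists, so the number of blocks is a successor. *)
have PQ : P \in set_partitions T #|P|.-1.+1.
  apply/set_partitionsP; rewrite prednK //; apply/card_gt0P; exists (pblock P x0).
  by rewrite pblock_mem // (cover_partition partP) inE.
exists #|P|.-1, P => // x y.
by rewrite (block_index_eq x0 PQ) (pblock_equivalence_partition eqRT) ?inE.
Qed.

From mathcomp Require Import finmap.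
From mathcomp Require Import boolp classical_sets cardinality.

Section Sublattices.
Local Open Scope ring_scope.
Local Open Scope classical_set_scope.

(** * Rank over [Z], and finiteness in full rank *)

Lemma ffunMzE n (v : 'Zn_n) (a : int) i : (v *~ a) i = v i * a.
Proof. by rewrite -mulrzz; case: a => m; rewrite ?NegzE ?mulrNz ?ffunE -?pmulrn ffunMnE. Qed.

Lemma lincomb_mxE n m (b : 'I_m -> 'Zn_n) (c : 'rV[int]_m) j :
  (\sum_(i < m) b i *~ c 0 i) j = (c *m \matrix_(i, j) b i j) 0 j.
Proof. by rewrite sum_ffunE mxE; apply: eq_bigr => i _; rewrite ffunMzE !mxE mulrC. Qed.

Lemma Zindependent_mx n m (b : 'I_m -> 'Zn_n) (c : 'rV[int]_m) :
  Zindependent b -> c *m (\matrix_(i, j) b i j) = 0 -> c = 0.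
Proof.
move=> indb cb0; apply/rowP=> i; rewrite [RHS]mxE; apply: (indb (c 0)).
by apply/ffunP=> j; rewrite lincomb_mxE cb0 mxE ffunE.
Qed.

Lemma Zindependent_leq n m (b : 'I_m -> 'Zn_n) : Zindependent b -> (m <= n)%N.
Proof.
move=> indb; rewrite leqNgt; apply/negP=> ltnm.
pose M : 'M[int]_(m, n) := \matrix_(i, j) b i j.
(* Zero columns pad [M] to a square matrix. Column [n] is one of them since [n < m], so the
   determinant vanishes and a left kernel vector gives a relation among the [b i]. *)
pose A : 'M[int]_m := \matrix_(i, j) oapp (M i) 0 (insub (j : nat)).
have /eqP/det0P[c c0 cA] : \det A = 0.
  rewrite (expand_det_col _ (Ordinal ltnm)) big1 // => i _.
  by rewrite mxE insubF ?mul0r //= ltnn.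
case/negP: c0; apply/eqP; apply: (Zindependent_mx indb); apply/rowP=> j.
have := congr1 (fun B : 'rV_m => B 0 (widen_ord (ltnW ltnm) j)) cA.
rewrite !mxE; apply: etrans; apply: eq_bigr => i _; congr (_ * _); rewrite !mxE /=.
by case: insubP => [u _ /= uj|]; [rewrite mxE; congr (b i _); apply: val_inj | rewrite /= ltn_ord].
Qed.

Lemma sublattice_sum n (L : set 'Zn_n) m (b : 'I_m -> 'Zn_n) (c : 'I_m -> int) :
  is_sublattice L -> (forall i, L (b i)) -> L (\sum_(i < m) b i *~ c i).
Proof.
by case=> L0 LD LM Lb; elim/big_ind: _ => // i _; apply: LM.
Qed.

(* The multiplier is the determinant of [n] independent vectors, by Cramer's rule. *)
Lemma full_rank_multiple n (L : set 'Zn_n) : is_sublattice L -> has_rank L n ->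
  exists2 d : int, d != 0 & forall v, L (v *~ d).
Proof.
move=> sL [[b [Lb indb]] _]; pose A : 'M[int]_n := \matrix_(i, j) b i j.
exists (\det A).
  by apply/det0P => -[c /negP c0 cA]; apply/c0/eqP; apply: (Zindependent_mx indb).
move=> v; pose c := (\row_j v j) *m \adj A.
suff -> : v *~ \det A = \sum_(i < n) b i *~ c 0 i by exact: sublattice_sum.
apply/ffunP=> j; rewrite lincomb_mxE -mulmxA mul_adj_mx mul_mx_scalar ffunMzE.
by rewrite !mxE mulrC.
Qed.

Lemma is_sublatticeN n (L : set 'Zn_n) u : is_sublattice L -> L u -> L (- u).
Proof. by case=> _ _ LM Lu; rewrite -mulrN1z; apply: LM. Qed.

(* Among the [r.+1] cosets of the multiples [0, v, ..., r v] two coincide. *)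
Lemma index_multiple n r (L : set 'Zn_n) v : is_sublattice L -> has_rank L n ->
  (quotient_torsion L #= `I_r)%card -> L (v *+ r`!).
Proof.
move=> sL rkL cardL; have [L0 LD LM] := sL.
have [d d0 Ld] := full_rank_multiple sL rkL.
pose coset i := [set v *+ i + l | l in L].
have [inj|] := pselect ({in `I_r.+1 &, injective coset}).
  have : (`I_r.+1 #<= `I_r)%card.
    rewrite -(card_le_eql (inj_card_eq inj)) -(card_le_eqr cardL).
    (* Full rank makes every vector torsion modulo [L], because [|d|] kills it; hence all these
       cosets are among the [r] torsion ones. *)
    apply: subset_card_le => _ [i _ <-]; exists (v *+ i) => //=.
    exists `|d|%N; first by rewrite absz_gt0.
    rewrite -mulrnA mulnC mulrnA.
    suff Lv : L (v *+ `|d|%N) by rewrite pmulrn; exact: LM.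
    by rewrite pmulrn abszE; case: (ger0P d) => _ //; rewrite mulrNz; apply: is_sublatticeN.
  by rewrite card_le_II ltnn.
move=> ninj.
have [i [j [ltij ljr eqij]]] : exists i j : nat, [/\ (i < j)%N, (j <= r)%N & coset i = coset j].
  apply: contrapT => H; apply: ninj => i j; rewrite !inE /= !ltnS => ir jr eqij.
  case: (ltngtP i j) => // [ltij|ltji]; case: H; first by exists i, j.
  by exists j, i.
have Lji : L (v *+ (j - i)).
  have : coset j (v *+ j) by exists 0; rewrite ?addr0.
  rewrite -eqij => -[l Ll] eqj.
  by rewrite mulrnBr ?(ltnW ltij) // -eqj addrAC subrr add0r.
have /dvdnP[q ->] : (j - i %| r`!)%N.
  by rewrite dvdn_fact // subn_gt0 ltij (leq_trans (leq_subr _ _)).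
by rewrite mulnC mulrnA pmulrn; apply: LM.
Qed.

(** Since [L] contains [r! Z^n], it is a union of residue classes modulo [r!], written [M.+1] below,
    and there are finitely many sets of such classes. *)
Lemma finite_mul_sublattices0 n r : finite_set (mul_sublattices n 0 r).
Proof.
have [M Mr] : exists M, r`! = M.+1 by exists r`!.-1; rewrite prednK ?fact_gt0.
pose lift_mod (w : {ffun 'I_n -> 'I_M.+1}) : 'Zn_n := [ffun i => (w i : nat)%:Z].
pose preim (A : {set {ffun 'I_n -> 'I_M.+1}}) : set 'Zn_n :=
  [set v | exists2 w, w \in A & exists u : 'Zn_n, v = lift_mod w + u *+ M.+1].
apply: (sub_finite_set _ (finite_image preim (finite_finset (X := setT)))).
move=> L [sL _ [d rkL dn] cardL]; rewrite addn0 in dn; rewrite {d}dn in rkL.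
have [L0 LD LM] := sL.
have LMn (u : 'Zn_n) : L (u *+ M.+1).
  by rewrite -Mr; exact: (index_multiple u sL rkL cardL).
exists (finset (fun w => `[< L (lift_mod w) >])) => //; apply/seteqP; split=> v.
  by case=> w; rewrite inE => /asboolP Lw [u ->]; apply: LD.
move=> Lv; pose w := [ffun i => inord `|(v i %% M.+1)%Z|%N : 'I_M.+1].
pose u : 'Zn_n := [ffun i => (v i %/ M.+1)%Z].
have def_v : v = lift_mod w + u *+ M.+1.
  apply/ffunP=> i; rewrite !ffunE ffunMnE ffunE inordK.
    by rewrite gez0_abs ?modz_ge0 // addrC pmulrn mulrzz -divz_eq.
  by rewrite -ltz_nat gez0_abs ?modz_ge0 // ltz_pmod.
exists w; last by exists u.
rewrite inE; apply/asboolP.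
have -> : lift_mod w = v + - (u *+ M.+1) by rewrite {1}def_v addrK.
by apply: LD => //; apply: is_sublatticeN.
Qed.

(* [ord0] is the extra coordinate. *)
Definition ext N (v : 'Zn_N) (x : 'I_N.+1) : int := oapp v 0 (unlift ord0 x).

Lemma ext0 N (v : 'Zn_N) : ext v ord0 = 0.
Proof. by rewrite /ext unlift_none. Qed.

Lemma ext_lift N (v : 'Zn_N) i : ext v (lift ord0 i) = v i.
Proof. by rewrite /ext liftK. Qed.

Lemma extMn N (v : 'Zn_N) m x : ext (v *+ m) x = ext v x *+ m.
Proof. by rewrite /ext; case: unlift => [i|] /=; rewrite ?ffunMnE ?mul0rn. Qed.

(** * The embedding of [Z^n] into [Z^N] attached to a numbering of blocks *)

Section Pull.
Variables (N n : nat) (g : 'I_N.+1 -> option 'I_n).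

(** The value 0 on the fibre of [None] accounts for the coordinates on which a whole lattice
    vanishes. *)
Definition pull (v : 'Zn_n) : 'Zn_N := [ffun i => oapp v 0 (g (lift ord0 i))].

Lemma pullD u v : pull (u + v) = pull u + pull v.
Proof. by apply/ffunP=> i; rewrite !ffunE; case: (g _) => [j|] /=; rewrite ?ffunE ?addr0. Qed.

Lemma pullM u v : pull (u * v) = pull u * pull v.
Proof. by apply/ffunP=> i; rewrite !ffunE; case: (g _) => [j|] /=; rewrite ?ffunE ?mulr0. Qed.

Lemma pull0 : pull 0 = 0.
Proof. by apply/ffunP=> i; rewrite !ffunE; case: (g _) => [j|] //=; rewrite ffunE. Qed.

Lemma pullMz v (a : int) : pull (v *~ a) = pull v *~ a.
Proof.
by apply/ffunP=> i; rewrite ffunMzE !ffunE; case: (g _) => [j|] /=; rewrite ?ffunMzE ?mul0r.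
Qed.

Lemma pullMn v m : pull (v *+ m) = pull v *+ m.
Proof. by rewrite !pmulrn pullMz. Qed.

Lemma pull_sum m (b : 'I_m -> 'Zn_n) : pull (\sum_i b i) = \sum_i pull (b i).
Proof. exact: (big_morph pull pullD pull0). Qed.

Hypotheses (g0 : g ord0 = None) (gsurj : forall j, exists x, g x = Some j).

Lemma pull_hits j : exists i, g (lift ord0 i) = Some j.
Proof.
have [x gx] := gsurj j; case: (unliftP ord0 x) => [i|] xE; first by exists i; rewrite -xE.
by move: gx; rewrite xE g0.
Qed.

Lemma pull_inj : injective pull.
Proof.
move=> u v /ffunP eqp; apply/ffunP=> j; have [i gi] := pull_hits j.
by have := eqp i; rewrite !ffunE gi.
Qed.

Lemma ext_pull v x : ext (pull v) x = oapp v 0 (g x).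
Proof.
by rewrite /ext; case: unliftP => [i|] -> /=; rewrite ?ffunE ?g0.
Qed.

(** The value of [u] at [j] is read off any coordinate numbered [j]; on the fibre of [None],
    comparison with [ord0] forces the value 0. *)
Lemma pull_range v : (forall x y, g x = g y -> ext v x = ext v y) ->
  exists u, v = pull u.
Proof.
move=> gv; exists [ffun j => v (projT1 (cid (pull_hits j)))].
apply/ffunP=> i; rewrite -(ext_lift v) ffunE.
case gi: (g _) => [j|] /=; last by rewrite (gv _ ord0) ?ext0 // gi g0.
by rewrite ffunE; case: cid => i' /= gi'; rewrite -ext_lift; apply: gv; rewrite gi gi'.
Qed.

Lemma pull_memE (L : set 'Zn_n) v : (pull @` L) (pull v) <-> L v.
Proof. by split=> [[u Lu /pull_inj <-]|Lv] //; exists v. Qed.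

Lemma pull_Zindependent m (b : 'I_m -> 'Zn_n) :
  Zindependent (pull \o b) <-> Zindependent b.
Proof.
have sumE (c : 'I_m -> int) : \sum_i (pull \o b) i *~ c i = pull (\sum_i b i *~ c i).
  by rewrite pull_sum; apply: eq_bigr => i _; rewrite pullMz.
split=> ind c c0; apply: ind; first by rewrite sumE c0 pull0.
by apply: pull_inj; rewrite -sumE c0 pull0.
Qed.

Lemma pull_sublattice (L : set 'Zn_n) : is_sublattice (pull @` L) <-> is_sublattice L.
Proof.
split=> -[L0 LD LM]; split.
- by apply/pull_memE; rewrite pull0.
- by move=> u v Lu Lv; apply/pull_memE; rewrite pullD; apply: LD; apply/pull_memE.
- by move=> a u Lu; apply/pull_memE; rewrite pullMz; apply: LM; apply/pull_memE.
- by rewrite -pull0; apply/pull_memE.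
- by move=> _ _ [u Lu <-] [v Lv <-]; rewrite -pullD; apply/pull_memE; apply: LD.
- by move=> a _ [u Lu <-]; rewrite -pullMz; apply/pull_memE; apply: LM.
Qed.

Lemma pull_mul_closed (L : set 'Zn_n) : mul_closed (pull @` L) <-> mul_closed L.
Proof.
split=> LM.
- by move=> u v Lu Lv; apply/pull_memE; rewrite pullM; apply: LM; apply/pull_memE.
- by move=> _ _ [u Lu <-] [v Lv <-]; rewrite -pullM; apply/pull_memE; apply: LM.
Qed.

Lemma lift_family (L : set 'Zn_n) m (b : 'I_m -> 'Zn_N) :
  (forall i, (pull @` L) (b i)) ->
  exists2 b', (forall i, L (b' i)) & b = pull \o b'.
Proof.
move=> /(_ _)/cid2 Lb; exists (fun i => s2val (Lb i)) => [i|]; first exact: (s2valP (Lb i)).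
by apply/funext=> i /=; rewrite (s2valP' (Lb i)).
Qed.

Lemma pull_has_rank (L : set 'Zn_n) d : has_rank (pull @` L) d <-> has_rank L d.
Proof.
split=> -[[b [Lb indb]] maxd]; split.
- have [b' Lb' bE] := lift_family Lb; exists b'; split=> //.
  by apply/pull_Zindependent; rewrite -bE.
- move=> m c Lc /pull_Zindependent; apply: maxd => i; exact/pull_memE.
- exists (pull \o b); split; first by move=> i; apply/pull_memE.
  exact/pull_Zindependent.
- move=> m c /lift_family[c' Lc' ->] /pull_Zindependent; exact: maxd.
Qed.

Lemma pull_torsion (L : set 'Zn_n) :
  quotient_torsion (pull @` L) = (image^~ pull) @` quotient_torsion L.
Proof.
have cosetE v : [set pull v + l | l in pull @` L] = pull @` [set v + l | l in L].
  by rewrite !image_comp; apply: eq_imagel => l _ /=; rewrite pullD.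
apply/seteqP; split=> [_ [v [m m0 [l Ll lE]] <-]|_ [_ [v [m m0 Lv] <-] <-]]; last first.
  by exists (pull v); rewrite ?cosetE //; exists m => //; rewrite -pullMn; apply/pull_memE.
have [u uE] : exists u, v = pull u.
  (* The multiple [v *+ m] is constant on the fibres of [g], and [Z] is torsion-free, so [v] is
     constant on them too. *)
  apply: pull_range => x y gxy; apply: (@pmulrnI _ m) => //.
  by rewrite -!extMn -lE !ext_pull gxy.
exists [set u + l | l in L]; last by rewrite uE cosetE.
by exists u => //; exists m => //; apply/pull_memE; rewrite pullMn -uE; exists l.
Qed.

Lemma pull_card_torsion (L : set 'Zn_n) r :
  (quotient_torsion (pull @` L) #= `I_r)%card = (quotient_torsion L #= `I_r)%card.
Proof.
rewrite pull_torsion; apply: card_eql; apply: inj_card_eq => A B _ _ eqAB.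
by apply/seteqP; split=> v Av; apply/pull_memE; [rewrite -eqAB | rewrite eqAB]; apply/pull_memE.
Qed.

End Pull.

(** Both co-rank conditions say that the rank is [n]. *)
Lemma pull_mul_sublattices n k r (g : 'I_(n + k).+1 -> option 'I_n) (L : set 'Zn_n) :
  g ord0 = None -> (forall j, exists x, g x = Some j) ->
  mul_sublattices (n + k) k r (pull g @` L) <-> mul_sublattices n 0 r L.
Proof.
move=> g0 gsurj; rewrite /mul_sublattices /= (pull_card_torsion g0 gsurj).
split=> -[sL mL [d rkd dE] cL]; split=> //;
  try by [apply/(pull_sublattice g0 gsurj) | apply/(pull_mul_closed g0 gsurj)].
- exists d; first exact/(pull_has_rank g0 gsurj).
  by rewrite addn0; exact: (addIn dE).
- by exists d; [exact/(pull_has_rank g0 gsurj) | rewrite -dE addn0].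
Qed.

(** * Inseparability classes recover the embedding *)

Definition inseparable N (L : set 'Zn_N) (x y : 'I_N.+1) : Prop :=
  forall v, L v -> ext v x = ext v y.

(* If [u] separates [x] from [y], then [w * u - u(y) w] still vanishes wherever
   [w] does, also vanishes at [y], and does not vanish at [x]. *)
Lemma isolating_vector N (L : set 'Zn_N) x v :
  is_sublattice L -> mul_closed L -> L v -> ext v x != 0 ->
  exists w, [/\ L w, ext w x != 0 &
    forall y, ~ inseparable L x y -> ext w y = 0].
Proof.
move=> [L0 LD LM] mL Lv vx.
suff [w [Lw wx wy]] : exists w, [/\ L w, ext w x != 0 &
    forall y, y \in enum 'I_N.+1 -> ~ inseparable L x y -> ext w y = 0].
  by exists w; split=> // y; apply: wy; rewrite mem_enum.
elim: (enum _) => [|y s [w [Lw wx wy]]]; first by exists v.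
have [Rxy|/existsNP[u /not_implyP[Lu uxy]]] := pselect (inseparable L x y).
  by exists w; split=> // z; rewrite inE => /predU1P[->|] // zs; apply: wy.
have extE z : ext (w * u + w *~ - ext u y) z = ext w z * (ext u z - ext u y).
  rewrite /ext; case: (unlift _ z) => [i|] /=; last by rewrite mul0r.
  by rewrite !ffunE ffunMzE mulrDr.
exists (w * u + w *~ - ext u y); split.
- by apply: LD; [apply: mL | apply: LM].
- by rewrite extE mulf_neq0 // subr_eq0; apply/eqP.
- move=> z; rewrite inE => /predU1P[->|zs] nR; rewrite extE; first by rewrite subrr mulr0.
  by rewrite wy // mul0r.
Qed.

(** [L] descends along its own inseparability classes to a lattice [M] in [Z^m]; comparing ranks
    then forces [m = n]. *)
Lemma mul_sublattice_pull n k r (L : set 'Zn_(n + k)) : mul_sublattices (n + k) k r L ->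
  exists2 P, P \in set_partitions 'I_(n + k).+1 n.+1 &
    exists M : set 'Zn_n, L = pull (block_index P ord0 n) @` M.
Proof.
case=> sL mL [d rkL /addIn dn] _; rewrite {d}dn in rkL.
have eqR : equivalence_rel (fun x y => `[< inseparable L x y >]).
  move=> x y z; split; first by apply/asboolP.
  by move=> /asboolP Rxy; apply/asboolP/asboolP => R v Lv; rewrite -(R v Lv) (Rxy v Lv).
have [m [P PQ PR]] := equivalence_block_index ord0 eqR.
pose g := block_index P ord0 m.
have g0 : g ord0 = None := block_index0 _ PQ.
have gsurj j : exists x, g x = Some j := block_index_surj _ PQ j.
have gR x y : g x = g y <-> inseparable L x y.
  by split=> [/eqP|R]; last apply/eqP; rewrite PR; [move/asboolP | apply/asboolP].
pose M := pull g @^-1` L.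
have LE : L = pull g @` M.
  apply/seteqP; split=> [v Lv|_ [u Mu <-]] //.
  have [u vE] : exists u, v = pull g u.
    by apply: (pull_range g0 gsurj) => x y /gR; apply.
  by exists u => //; rewrite /M /= -vE.
have [[b [Mb indb]] maxM] : has_rank M n.
  by apply/(pull_has_rank g0 gsurj); rewrite -LE.
have lenm : (n <= m)%N := Zindependent_leq indb.
have diagM j : exists u, [/\ M u, u j != 0 & forall i, i != j -> u i = 0].
  have [x gx] := gsurj j.
  have [v Lv vx] : exists2 v, L v & ext v x != 0.
    (* If all of [L] vanished at [x], then [x] would be inseparable from [ord0], which is numbered
       [None]. *)
    apply: contrapT => H; have : g x = g ord0.
      apply/gR => v Lv; rewrite ext0; apply/eqP; rewrite -[_ == _]negbK.
      by apply/negP=> vx; apply: H; exists v.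
    by rewrite gx g0.
  have [w [Lw wx wy]] := isolating_vector sL mL Lv vx.
  have := Lw; rewrite LE => -[u Mu uE]; exists u; split=> //.
    by move: wx; rewrite -uE (ext_pull g0) gx.
  move=> i ij; have [y gy] := gsurj i.
  have <- : ext w y = u i by rewrite -uE (ext_pull g0) gy.
  apply: wy => /gR; rewrite gx gy => -[ji]; by rewrite ji eqxx in ij.
have [c cP] := choice diagM.
(* Each [c j] is a nonzero multiple of a unit vector, so these [m] vectors of [M] are independent,
   while [M] has rank [n]. *)
have mlen : (m <= n)%N.
  apply: (maxM _ c) => [j|a a0 j]; first by case: (cP j).
  have /ffunP/(_ j) := a0; rewrite sum_ffunE (bigD1 j) //= big1 => [|i ij].
    rewrite addr0 ffunMzE ffunE => /eqP; rewrite mulf_eq0.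
    by case: (cP j) => _ /negPf-> _ /eqP.
  by rewrite ffunMzE; have [_ _ ->] := cP i; rewrite ?mul0r // eq_sym.
have mn : m = n by apply/eqP; rewrite eqn_leq mlen lenm.
by subst m; exists P; [|exists M].
Qed.

(** Full rank puts a nonzero multiple of each unit vector in [L]; the images of these separate any
    two coordinates with different values of [g], [None] included. *)
Lemma inseparable_pull N n (g : 'I_N.+1 -> option 'I_n) (L : set 'Zn_n) x y :
  g ord0 = None -> is_sublattice L -> has_rank L n ->
  inseparable (pull g @` L) x y <-> g x = g y.
Proof.
move=> g0 sL rkL; split=> [R|gxy v [u Lu <-]]; last by rewrite !(ext_pull g0) gxy.
have [d d0 Ld] := full_rank_multiple sL rkL.
pose e j : 'Zn_n := [ffun i => (i == j)%:R].
have eR j : oapp (e j *~ d) 0 (g x) = oapp (e j *~ d) 0 (g y).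
  by rewrite -!(ext_pull g0); apply: R; exists (e j *~ d).
have eE i j : (e j *~ d) i = (i == j)%:R * d by rewrite ffunMzE ffunE.
case gx: (g x) => [i|]; case gy: (g y) => [j|] //.
- have := eR j; rewrite gx gy /= !eE eqxx mul1r; case: eqP => [->|_] //.
  by rewrite mul0r => /eqP; rewrite eq_sym (negPf d0).
- by have := eR i; rewrite gx gy /= eE eqxx mul1r => /eqP; rewrite (negPf d0).
- by have := eR j; rewrite gx gy /= eE eqxx mul1r => /eqP; rewrite eq_sym (negPf d0).
Qed.

(** * Counting pairs of a partition and a full-rank lattice *)

Lemma card_fsetM (T U : choiceType) (A : {fset T}) (B : {fset U}) :
  #|` (A `*` B)%fset| = (#|` A| * #|` B|)%N.
Proof.
pose f (p : A * B) := (val p.1, val p.2).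
have finj : injective f by move=> [a b] [a' b'] [/val_inj -> /val_inj ->].
have -> : (A `*` B)%fset = (f @` {: A * B})%fset.
  apply/fsetP=> -[a b]; rewrite in_fsetM /=; apply/andP/imfsetP => [[aA bB]|[[a' b'] _ [-> ->]]].
    by exists ([` aA]%fset, [` bB]%fset).
  by split; apply: valP.
by rewrite card_imfset //= -cardE card_prod !cardfE.
Qed.

End Sublattices.

Theorem theorem2 (n k r : nat) (hr : (1 <= r)%N) :
  finite_set (mul_sublattices (n + k) k r) /\
  phi_corank (n + k) k r = (stirling2 (n + k + 1) (n + 1) * phi n r)%N.
Proof.
rewrite !addn1 /phi /stirling2 /phi_corank.
pose Q := set_partitions 'I_(n + k).+1 n.+1.
pose Y := mul_sublattices n 0 r.
pose f (p : {set {set 'I_(n + k).+1}} * set 'Zn_n) : set 'Zn_(n + k) :=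
  (pull (block_index p.1 ord0 n) @` p.2)%classic.
(* Finiteness matters because [fset_set] sends infinite sets to the empty one. *)
have finQ : finite_set [set` Q]%classic := finite_finpred Q.
have finY : finite_set Y := finite_mul_sublattices0 n r.
have finQY := finite_setX finQ finY.
have XE : mul_sublattices (n + k) k r = (f @` ([set` Q] `*` Y))%classic.
  apply/seteqP; split=> [L XL|_ [[P M] [/= PQ YM] <-]].
    have [P PQ [M LE]] := mul_sublattice_pull XL.
    exists (P, M) => //; split=> //.
    by apply/(pull_mul_sublattices _ _ (block_index0 _ PQ) (block_index_surj _ PQ)); rewrite -LE.
  exact/(pull_mul_sublattices _ _ (block_index0 _ PQ) (block_index_surj _ PQ)).
have rankY M : Y M -> is_sublattice M /\ has_rank M n.
  by case=> sM _ [d rkM dn] _; split=> //; rewrite addn0 in dn; rewrite -[X in has_rank _ X]dn.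
have f_inj : {in [set` Q] `*` Y &, injective f}%classic.
  move=> [P M] [P' M'] /[!inE] -[/= PQ /rankY[sM rkM]] [/= PQ' /rankY[sM' rkM']].
  (* Equal images have the same inseparability classes, which gives back the partition; injectivity
     of the embedding then gives back the lattice. *)
  rewrite /f /= => eqf; have eqP : P = P'.
    apply: (block_index_inj PQ PQ' (x0 := ord0)) => x y.
    rewrite -(inseparable_pull x y (block_index0 _ PQ) sM rkM) eqf.
    exact: (inseparable_pull x y (block_index0 _ PQ') sM' rkM').
  congr (_, _) => //; subst P'; apply/seteqP; split=> v;
    move=> /(pull_memE (block_index0 _ PQ) (block_index_surj _ PQ)).
    by rewrite eqf => /(pull_memE (block_index0 _ PQ) (block_index_surj _ PQ)).
  by rewrite -eqf => /(pull_memE (block_index0 _ PQ) (block_index_surj _ PQ)).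
split; first by rewrite XE; exact: finite_image.
rewrite XE fset_set_image // card_in_imfset /=; last first.
  by move=> p q; rewrite !in_fset_set //; exact: f_inj.
rewrite fset_setX // card_fsetM; congr (_ * _)%N.
rewrite -card_finset; congr #|` _|%fset; apply/fsetP=> P.
by rewrite in_fset_set // mem_setE !inE.
Qed.
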